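(* For every integer $k \geq 2$, if a bipartite graph $G$ has minimum degree at least $k(k-1)$, then $G$ has a $\frac{1}{k}$-majority $(k+1)$-edge-colouring.
   Context: Graphs are finite and simple. For an integer $k\geq 2$, a $\frac{1}{k}$-majority $l$-edge-colouring of a graph $G$ is an assignment to each edge of $G$ of one of $l$ colours such that for every colour $i$ and every vertex $v$ of $G$, at most $\frac{d_G(v)}{k}$ of the edges incident with $v$ have colour $i$ (where $d_G(v)$ is the degree of $v$). *)

(* Defs.v *)
From mathcomp Require Import all_boot all_order all_algebra.

Set Implicit Arguments.
Unset Strict Implicit.
Unset Printing Implicit Defensive.

Record sgraph := SGraph {
  vertex :> finType;
  adj : rel vertex;
  adj_sym : symmetric adj;
  adj_irrefl : irreflexive adj }.

Definition edge_set (G : sgraph) : {set {set G}} :=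
  [set [set p.1; p.2] | p : G * G & adj p.1 p.2].

Definition edge (G : sgraph) : finType := {E : {set G} | E \in edge_set G}.

Definition incident_edges (G : sgraph) (v : G) : {set edge G} :=
  [set E : edge G | v \in val E].

Definition degree (G : sgraph) (v : G) : nat := #|incident_edges v|.

Definition bipartite (G : sgraph) : Prop :=
  exists A : {set G}, forall x y : G, adj x y -> (x \in A) != (y \in A).

(* A 1/k-majority l-edge-colouring. The bound d(v)/k is a rational number, with
   no rounding; for k = 0 it would be 0, as division by zero yields 0. *)
Definition majority_edge_colouring (k l : nat) (G : sgraph)
    (c : edge G -> 'I_l) : Prop :=
  forall (i : 'I_l) (v : G),
    (#|[set E in incident_edges v | c E == i]|%:R
       <= (degree v)%:R / k%:R :> rat)%R.

(* Main.v *)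
Require Import Defs.
From mathcomp Require Import all_boot all_order all_algebra.
From mathcomp Require Import perm.

(**
  Write d(v) = q k + r with r < k.  Since d(v) >= k (k - 1), we have
  r <= k - 1 <= q, hence d(v) <= q (k + 1), and the edges at v can be
  distributed over q slots of at most k + 1 edges each.  Splitting every vertex
  into its slots gives a bipartite graph of maximum degree at most k + 1, which
  by König's theorem has a proper (k + 1)-edge-colouring.  Each colour occurs at
  most once in each slot, hence at most q <= d(v) / k times at v.
*)

Set Implicit Arguments.
Unset Strict Implicit.
Unset Printing Implicit Defensive.

(** * König's edge-colouring theorem *)

(* A bipartite multigraph is given by its edge type [E] and the two endpoint
   maps [a] and [b]. *)
Definition proper_on (E : finType) (A B : eqType) (a : E -> A) (b : E -> B)
    (C : Type) (S : {set E}) (c : E -> C) : Prop :=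
  forall e f, e \in S -> f \in S -> c e = c f ->
    (a e = a f) \/ (b e = b f) -> e = f.

(** The uncoloured [e0] takes one of the at most [D] places at its own endpoint, so fewer than [D]
    colours are used there. *)
Lemma missing_colour (E : finType) (A : eqType) (a : E -> A) (D : nat)
    (S : {set E}) (c : E -> 'I_D) (e0 : E) :
  e0 \notin S -> #|[set f | a f == a e0]| <= D ->
  exists i, forall f, f \in S -> a f = a e0 -> c f != i.
Proof.
move=> e0S leD; set T := [set f in S | a f == a e0].
have ltT : #|T| < D.
  apply: leq_trans leD; apply: proper_card; apply/properP; split.
    by apply/subsetP => f; rewrite !inE => /andP[].
  by exists e0; rewrite !inE ?eqxx // (negPf e0S).
have: exists i, i \notin c @: T.
  apply/existsP; rewrite -negb_forall; apply/negP => /forallP ct.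
  have : #|'I_D| <= #|c @: T| by apply/subset_leq_card/subsetP => i _; exact: ct.
  by rewrite card_ord leqNgt (leq_ltn_trans (leq_imset_card c T)).
case=> i iT; exists i => f fS afe; apply: contraNneq iT => <-.
by apply: imset_f; rewrite inE fS afe eqxx.
Qed.

(* Kempe swap: exchange [i] and [j] along the alternating path that starts at
   the [b]-endpoint of [e0].  The path enters every [a]-vertex by an edge of
   colour [i], so it avoids the [a]-endpoint of [e0], where [i] is missing. *)
Lemma proper_on_extend (E A B : finType) (a : E -> A) (b : E -> B) (D : nat)
    (S : {set E}) (c : E -> 'I_D) (e0 : E) (i j : 'I_D) :
  proper_on a b S c -> e0 \notin S ->
  (forall f, f \in S -> a f = a e0 -> c f != i) ->
  (forall f, f \in S -> b f = b e0 -> c f != j) ->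
  exists c' : E -> 'I_D, proper_on a b (e0 |: S) c'.
Proof.
move=> cP e0S iP jP.
(* One [R]-step goes from [B] to [B] along an [i]-edge and then a [j]-edge; [Y] holds at the
   [B]-vertices of the alternating path. *)
pose R := [rel y z | [exists p : E * E,
  [&& p.1 \in S, p.2 \in S, c p.1 == i, c p.2 == j, b p.1 == y,
      a p.1 == a p.2 & b p.2 == z]]].
pose Y := connect R (b e0).
(* The path to [b f] is nonempty because [j] is missing at [b e0], and its last edge must be [f],
   the only [j]-edge at [b f]. *)
have backP f : f \in S -> c f = j -> Y (b f) ->
    exists e, [/\ e \in S, c e = i, a e = a f & Y (b e)].
  move=> fS cf /connectP [p].
  case/lastP: p => [|p z].
    by move=> _ /= bf; move: (jP f fS bf); rewrite cf eqxx.
  rewrite rcons_path last_rcons => /andP[pp /existsP[[e g] /=]].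
  case/and5P=> eS gS /eqP ce /eqP cg /and3P[/eqP be /eqP aeg /eqP bg] bfz.
  have gf : g = f by apply: cP; rewrite ?cf ?cg //; right; rewrite bg bfz.
  exists e; split; rewrite // -?gf // be.
  by apply/connectP; exists p.
have forwP e f : e \in S -> f \in S -> c e = i -> c f = j -> a e = a f ->
    Y (b e) -> Y (b f).
  move=> eS fS ce cf aef Ye; apply: connect_trans Ye (connect1 _).
  by apply/existsP; exists (e, f); rewrite /= eS fS ce cf aef !eqxx.
have samea e f : e \in S -> f \in S -> c e = i -> c f = j -> a e = a f ->
    Y (b e) = Y (b f).
  move=> eS fS ce cf aef; apply/idP/idP; first exact: forwP.
  case/(backP _ fS cf)=> g [gS cg agf Yg].
  suff <- : g = e by [].
  by apply: cP => //; [rewrite ce | left; rewrite agf].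
have Y0 : Y (b e0) by exact: connect0.
(* The [b]-endpoint decides the swap, so a swapped and an unswapped edge can meet only in [A], where
   [samea] excludes a clash of [i] with [j]. *)
pose c1 f := if Y (b f) then tperm i j (c f) else c f.
have c1P : proper_on a b S c1.
  have mixed e f : e \in S -> f \in S -> Y (b e) -> ~~ Y (b f) ->
      tperm i j (c e) = c f -> (a e = a f) \/ (b e = b f) -> e = f.
    move=> eS fS Ye Yf + [aef|bef]; last by rewrite -bef Ye in Yf.
    case: tpermP => [ce cf|ce cf|_ _ cef].
    - by rewrite -(samea e f) ?Ye in Yf.
    - by rewrite (samea f e) ?Ye in Yf.
    - by apply: cP => //; left.
  move=> e f eS fS; rewrite /c1.
  have [Ye|Ye] := boolP (Y (b e)); have [Yf|Yf] := boolP (Y (b f)).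
  - by move/perm_inj; exact: cP.
  - exact: mixed.
  - by move=> /esym cfe [] /esym ab; apply/esym/mixed => //; [left | right].
  - exact: cP.
have c1a f : f \in S -> a f = a e0 -> c1 f != i.
  move=> fS af; have ci := iP f fS af; rewrite /c1.
  case: ifP => // Yf; apply: contra_neq ci => tci.
  have cj : c f = j by apply: (@perm_inj _ (tperm i j)); rewrite tci tpermR.
  have [e [eS ce aef _]] := backP f fS cj Yf.
  by case/eqP: (iP e eS (etrans aef af)).
have c1b f : f \in S -> b f = b e0 -> c1 f != i.
  move=> fS bf; have cj := jP f fS bf; rewrite /c1 bf Y0.
  by apply: contra_neq cj => tci; apply: (@perm_inj _ (tperm i j)); rewrite tci tpermR.
exists (fun f => if f == e0 then i else c1 f) => e f.
rewrite !inE; have [->|ne] := eqVneq e e0; have [->|nf] := eqVneq f e0 => //=.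
- move=> _ fS cf [] af.
    by move: (c1a f fS (esym af)); rewrite -cf eqxx.
  by move: (c1b f fS (esym af)); rewrite -cf eqxx.
- move=> eS _ ce [] ae.
    by move: (c1a e eS ae); rewrite ce eqxx.
  by move: (c1b e eS ae); rewrite ce eqxx.
exact: c1P.
Qed.

Theorem konig_edge_colouring (E A B : finType) (a : E -> A) (b : E -> B)
    (D : nat) :
  (forall e, #|[set f | a f == a e]| <= D) ->
  (forall e, #|[set f | b f == b e]| <= D) ->
  exists c : E -> 'I_D, proper_on a b setT c.
Proof.
move=> aD bD.
have [e0 _|noE] := pickP E; last first.
  (* [D] may be 0 here, so no default colour exists and the colouring is the empty function. *)
  by exists (fun e => False_rect _ (elimF idP (noE e) isT)) => e; have := noE e.
have D0 : 0 < D.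
  by apply: leq_trans (aD e0); apply/card_gt0P; exists e0; rewrite inE.
suff ext n (S : {set E}) : #|S| = n -> exists c : E -> 'I_D, proper_on a b S c.
  exact: (ext _ _ erefl).
elim: n S => [S /eqP|n IHn S cardS].
  rewrite cards_eq0 => /eqP ->.
  by exists (fun=> Ordinal D0) => e f; rewrite inE.
have /card_gt0P [e eS] : 0 < #|S| by rewrite cardS.
have [|c cP] := IHn (S :\ e).
  by move: cardS; rewrite (cardsD1 e) eS add1n => -[].
have eS' : e \notin S :\ e by rewrite !inE eqxx.
have [i iP] := missing_colour c eS' (aD e).
have [j jP] := missing_colour c eS' (bD e).
rewrite -(setD1K eS).
exact: proper_on_extend cP eS' iP jP.
Qed.

(** * Splitting the vertices *)

Lemma inord_inj (n p q : nat) :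
  p < n.+1 -> q < n.+1 -> inord p = inord q :> 'I_n.+1 -> p = q.
Proof. by move=> pn qn /(congr1 val); rewrite /= !inordK. Qed.

Lemma card_le_inj_ltn (T : finType) (S : {set T}) (h : T -> nat) (q : nat) :
  {in S &, injective h} -> (forall x, x \in S -> h x < q) -> #|S| <= q.
Proof.
move=> hinj hq; rewrite cardE -(size_map h) -[leqRHS](size_iota 0 q).
apply: uniq_leq_size.
  rewrite map_inj_in_uniq ?enum_uniq // => x y.
  by rewrite !mem_enum; exact: hinj.
by move=> n /mapP[x]; rewrite mem_enum mem_iota => /hq xq ->.
Qed.

Section Slots.
Variables (k : nat) (G : sgraph).

Definition slot (v : G) (e : edge G) : nat :=
  index e (enum (incident_edges v)) %/ k.+1.

Lemma slot_lt (v : G) (e : edge G) (q : nat) :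
  e \in incident_edges v -> degree v <= q * k.+1 -> slot v e < q.
Proof.
move=> ev dq; rewrite ltn_divLR //; apply: leq_trans dq.
by rewrite /degree cardE index_mem mem_enum.
Qed.

(** This makes [inord] faithful on slot numbers, so split vertices with distinct slots stay
    distinct. *)
Lemma slot_lt_card (v : G) (e : edge G) : slot v e < #|edge G|.+1.
Proof.
rewrite ltnS (leq_trans (leq_div _ _)) // (leq_trans (index_size _ _)) //.
by rewrite -cardE max_card.
Qed.

(** A slot is a block of consecutive indices with a common quotient by [k.+1], so the remainder
    identifies an edge within it. *)
Lemma card_slot_fibre (v : G) (g : nat) :
  #|[set e in incident_edges v | slot v e == g]| <= k.+1.
Proof.
pose idx e := index e (enum (incident_edges v)).
apply: (@card_le_inj_ltn _ _ (fun e => idx e %% k.+1)) => [e f|e _]; last first.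
  exact: ltn_pmod.
rewrite [e \in _]inE [f \in _]inE => /andP[ev /eqP se] /andP[fv /eqP sf] hef.
have idx_ef : idx e = idx f.
  have def_idx x : idx x = slot v x * k.+1 + idx x %% k.+1 by exact: divn_eq.
  by rewrite def_idx hef se -sf -def_idx.
rewrite -mem_enum in ev; rewrite -mem_enum in fv.
by rewrite -(nth_index e ev) -/(idx e) idx_ef nth_index.
Qed.

Definition bipartition (X : {set G}) : Prop :=
  forall x y : G, adj x y -> (x \in X) != (y \in X).

Lemma bipartitionC (X : {set G}) : bipartition X -> bipartition (~: X).
Proof. by move=> Xb x y /Xb; rewrite !inE; do 2!case: (_ \in X). Qed.

(* The [None] case never occurs for the edges of a bipartite graph with side
   [X]: see [edge_meets_side]. *)
Definition split_end (X : {set G}) (e : edge G) : option (G * 'I_#|edge G|.+1) :=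
  omap (fun v => (v, inord (slot v e))) [pick x | x \in val e :&: X].

(** An edge has only one endpoint in [X], so the picked one must be [v]. *)
Lemma split_endE (X : {set G}) (e : edge G) (v : G) :
  bipartition X -> v \in X -> e \in incident_edges v ->
  split_end X e = Some (v, inord (slot v e)).
Proof.
move=> Xb vX; rewrite /split_end inE => ve.
case: pickP => [x|/(_ v)]; last by rewrite inE ve vX.
rewrite inE => /andP[xe xX] /=; suff -> : x = v by [].
case: e xe ve => s /= /imsetP [[y z]]; rewrite inE /= => yz ->.
have := Xb _ _ yz; rewrite !inE.
by move=> + /orP[]/eqP xE /orP[]/eqP vE; rewrite -?xE -?vE ?xX ?vX // xE vE.
Qed.

Lemma edge_meets_side (X : {set G}) (e : edge G) : bipartition X ->
  exists2 v, v \in X & e \in incident_edges v.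
Proof.
move=> Xb; case: (e) => s sE; case/imsetP: (sE) => [[y z]].
rewrite inE /= => yz sdef.
have := Xb _ _ yz; have [yX _|_ /=] := boolP (y \in X).
  by exists y; rewrite // inE /= sdef !inE eqxx.
by rewrite negbK => zX; exists z; rewrite // inE /= sdef !inE eqxx orbT.
Qed.

Lemma card_split_end_fibre (X : {set G}) (e : edge G) : bipartition X ->
  #|[set f | split_end X f == split_end X e]| <= k.+1.
Proof.
move=> Xb; have [v vX ev] := edge_meets_side e Xb.
apply: leq_trans (card_slot_fibre v (slot v e)).
apply/subset_leq_card/subsetP => f; rewrite !inE (split_endE Xb vX ev) => /eqP fE.
have [w wX fw] := edge_meets_side f Xb.
move: fE; rewrite (split_endE Xb wX fw) => /Some_inj /eqP.
rewrite xpair_eqE => /andP[/eqP wv /eqP]; rewrite -wv in ev *.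
move/(inord_inj (slot_lt_card _ _) (slot_lt_card _ _)) => ->.
by rewrite eqxx andbT; move: fw; rewrite inE.
Qed.

(** Edges at [v] in one slot share a split vertex, on the side of [X] or of its complement according
    to where [v] lies; properness there separates their colours. *)
Lemma slot_inj_on_colour (C : eqType) (X : {set G}) (c : edge G -> C) (i : C)
    (v : G) : bipartition X ->
  proper_on (split_end X) (split_end (~: X)) setT c ->
  {in [set e in incident_edges v | c e == i] &, injective (slot v)}.
Proof.
move=> Xb cP e f; rewrite [e \in _]inE [f \in _]inE.
move=> /andP[ev /eqP ce] /andP[fv /eqP cf] sef.
apply: cP (in_setT _) (in_setT _) (etrans ce (esym cf)) _.
have [vX|vX] := boolP (v \in X); [left | right].
  by rewrite (split_endE Xb vX ev) (split_endE Xb vX fv) sef.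
rewrite -in_setC in vX; have Xb' := bipartitionC Xb.
by rewrite (split_endE Xb' vX ev) (split_endE Xb' vX fv) sef.
Qed.

End Slots.

Lemma leq_divn_mulS (k d : nat) :
  0 < k -> k * (k - 1) <= d -> d <= d %/ k * k.+1.
Proof.
move=> k0 kd; rewrite {1}(divn_eq d k) mulnS addnC leq_add2r.
have rk : d %% k <= k - 1 by rewrite subn1 -ltnS prednK ?ltn_mod.
by apply: leq_trans rk _; rewrite leq_divRL // mulnC.
Qed.

Theorem theorem5 (k : nat) (hk : 2 <= k) (G : sgraph) (hG : bipartite G)
    (hdeg : forall v : G, k * (k - 1) <= degree v) :
  exists c : edge G -> 'I_(k + 1), majority_edge_colouring k c.
Proof.
have k0 : 0 < k by exact: ltnW.
have [X Xb] := hG.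
have [c cP] := konig_edge_colouring
  (fun e => card_split_end_fibre k e Xb)
  (fun e => card_split_end_fibre k e (bipartitionC Xb)).
rewrite addn1; exists c => i v.
rewrite Num.Theory.ler_pdivlMr ?Num.Theory.ltr0n // -GRing.natrM Num.Theory.ler_nat.
(* The count is an integer, so the rational bound amounts to a bound by [degree v %/ k], the number
   of slots at [v]. *)
rewrite -leq_divRL //; apply: card_le_inj_ltn (slot_inj_on_colour Xb cP) _ => e.
rewrite inE => /andP[ev _]; apply: slot_lt ev _.
exact: leq_divn_mulS.
Qed.
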